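(* For all integers $t\ge r\ge 3$, $$n^2e^{-O(\sqrt{\log n})}\le \mathrm{ex}_{K_t}(n,K_r)=o(n^2)\qquad (n\to\infty).$$ More generally, if $F$ and $G$ are connected graphs of girth $3$, then $\mathrm{ex}_F(n,G)\ge n^2e^{-O(\sqrt{\log n})}$.
   Context: For fixed nonempty simple graphs $F$ and $G$, $\mathrm{ex}_F(n,G)$ denotes the maximum number of pairwise edge-disjoint copies of $F$ that can be placed on an $n$-element vertex set so that the union of these copies contains no subgraph isomorphic to $G$ all of whose edges belong to pairwise different copies of $F$. $K_t$ denotes the complete graph on $t$ vertices; a graph of girth $3$ is one containing a triangle. *)

(* Defs.v *)
From HB Require Import structures.
From mathcomp Require Import all_boot all_order all_algebra.
From mathcomp Require Import all_classical all_reals all_analysis.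

Set Implicit Arguments.
Unset Strict Implicit.
Unset Printing Implicit Defensive.

Import Order.TTheory GRing.Theory Num.Theory.
Import numFieldNormedType.Exports.

Record sgraph := SGraph {
  vertex :> finType;
  adj : rel vertex;
  adj_sym : symmetric adj;
  adj_irrefl : irreflexive adj }.

Arguments adj {s} : rename.

Lemma neq_sym_rel (T : eqType) : symmetric (fun x y : T => x != y).
Proof. by move=> x y; rewrite eq_sym. Qed.

Lemma neq_irrefl_rel (T : eqType) : irreflexive (fun x y : T => x != y).
Proof. by move=> x; rewrite eqxx. Qed.

Definition complete_graph (t : nat) : sgraph :=
  @SGraph 'I_t _ (@neq_sym_rel 'I_t) (@neq_irrefl_rel 'I_t).

Definition connected_graph (G : sgraph) : Prop :=
  forall x y : G, connect adj x y.

(* In a simple graph no cycle is shorter than a triangle. *)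
Definition girth3 (G : sgraph) : Prop :=
  exists x y z : G, [/\ adj x y, adj y z & adj z x].

(* A pair (W, E): vertex set W, and edges E given as two-element sets. *)
Definition subgraph (n : nat) := ({set 'I_n} * {set {set 'I_n}})%type.

Definition edges (n : nat) (H : subgraph n) : {set {set 'I_n}} := H.2.

Definition image_graph (F : sgraph) (n : nat) (f : {ffun F -> 'I_n}) :
    subgraph n :=
  ([set f x | x : F],
   [set [set f p.1; f p.2] | p : F * F & adj p.1 p.2]).

(* The subgraph H of the complete graph on 'I_n is isomorphic to F. *)
Definition is_copy (F : sgraph) (n : nat) (H : subgraph n) : bool :=
  [exists f : {ffun F -> 'I_n}, injectiveb f && (H == image_graph f)].

Definition edge_disjoint_copies (F : sgraph) (n : nat)
    (A : {set subgraph n}) : bool :=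
  [forall H in A, is_copy F H] &&
  [forall H in A, forall K in A, (H != K) ==> [disjoint edges H & edges K]].

Definition rainbow (n : nat) (A : {set subgraph n}) (K : subgraph n) : bool :=
  (edges K \subset \bigcup_(H in A) edges H) &&
  [forall e1 in edges K, forall e2 in edges K, (e1 != e2) ==>
    [forall H1 in A, forall H2 in A,
       (e1 \in edges H1) && (e2 \in edges H2) ==> (H1 != H2)]].

Definition has_rainbow (G : sgraph) (n : nat) (A : {set subgraph n}) : bool :=
  [exists K : subgraph n, is_copy G K && rainbow A K].

Definition multicolor_ex (F : sgraph) (n : nat) (G : sgraph) : nat :=
  \max_(A : {set subgraph n} |
        edge_disjoint_copies F A && ~~ has_rainbow G A) #|A|.

Local Open Scope ring_scope.
Local Open Scope classical_set_scope.

(* a n >= n^2 e^{-O(sqrt(log n))} as n tends to infinity *)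
Definition near_quadratic_lower (R : realType) (a : nat -> nat) : Prop :=
  exists2 h : nat -> R,
    h =O_\oo (fun n : nat => Num.sqrt (ln n%:R) : R) &
    \forall n \near \oo, n%:R ^+ 2 * expR (- h n) <= (a n)%:R.

Definition subquadratic (R : realType) (a : nat -> nat) : Prop :=
  (fun n : nat => (a n)%:R : R) =o_\oo (fun n : nat => n%:R ^+ 2 : R).

(* Main.v *)
Require Import Defs.
From HB Require Import structures.
From mathcomp Require Import all_boot all_order all_algebra.
From mathcomp Require Import all_classical all_reals all_analysis.
(* Imported again so that the finite-set names shadow the classical ones. *)
From mathcomp Require Import fintype finset bigop.
From mathcomp Require Import ring lra zify.

(* Upper bound. The vertex sets of edge-disjoint copies of K_t form a linear
   family of t-sets. Take a Szemeredi partition (energy increment, cells of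
   arbitrary size) of the graph of all covered pairs. If there are more than
   delta n^2 copies, some copy contains no pair lying between cells that are
   small, sparse or irregular, since every such pair lies in at most one copy.
   The cells of r vertices of that copy are then pairwise dense and regular, so
   a K_r can be embedded greedily; every new vertex only has to avoid the
   boundedly many vertices on a copy through two earlier ones, and this makes
   the K_r rainbow.

   Lower bound. Since G contains a triangle it suffices to exclude rainbow
   triangles. As in Behrend's construction, use the copies v |-> (v, x + i(v) a),
   where x ranges over a box of Z^m and a over the most popular sphere in it:
   three copies forming a triangle give a relation al a + be b + ga c = 0 with
   nonzero coefficients of sum 0 between points of a sphere, whence a = b = c.
   Working in Z^m instead of Z avoids any discussion of carries. With the box
   [0, 2^s)^(s - #|F|) and s^2 about log_2 n, the loss is 2^(O(s)). *)

Set Implicit Arguments.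
Unset Strict Implicit.
Unset Printing Implicit Defensive.

Import Order.TTheory GRing.Theory Num.Theory.
Local Open Scope ring_scope.

(** * Regularity of a coloured vertex set *)

(** Conditional expectation of [f] given [C]; an empty class gets the value 0, since division by 0
    yields 0. *)
Definition avg (R : realFieldType) (T L : finType) (C : T -> L) (f : T -> R)
    (l : L) : R :=
  (\sum_(x | C x == l) f x) / #|[pred x | C x == l]|%:R.

Definition energy (R : realFieldType) (T L : finType) (C : T -> L)
    (f : T -> R) : R :=
  \sum_x avg C f (C x) ^+ 2.

(** Conditional expectation is self-adjoint: after exchanging the sums, [f y] occurs once for each
    point of the class of [y], which cancels the division by the class size. *)
Lemma sum_avg (R : realFieldType) (T L : finType) (C : T -> L) (f : T -> R)
    (g : L -> R) :
  \sum_x avg C f (C x) * g (C x) = \sum_x f x * g (C x).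
Proof.
transitivity (\sum_x \sum_(y | C y == C x)
                 f y * (g (C x) / #|[pred z | C z == C x]|%:R)).
  by apply: eq_bigr => x _; rewrite -mulr_suml /avg mulrAC -mulrA.
rewrite (exchange_big_dep predT) //=; apply: eq_bigr => y _.
rewrite (eq_bigr (fun=> f y * (g (C y) / #|[pred z | C z == C y]|%:R)));
  last by move=> x /eqP->.
rewrite (eq_bigl (mem [pred z | C z == C y])); last first.
  by move=> x; rewrite !inE eq_sym.
rewrite sumr_const -[LHS]mulr_natr -!mulrA mulVf ?mulr1 //.
by rewrite pnatr_eq0 -lt0n; apply/card_gt0P; exists y; rewrite inE.
Qed.

Lemma avg_ge0 (R : realFieldType) (T L : finType) (C : T -> L) (f : T -> R) l :
  (forall x, 0 <= f x) -> 0 <= avg C f l.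
Proof. by move=> f0; rewrite divr_ge0 ?ler0n ?sumr_ge0. Qed.

Lemma avg_le1 (R : realFieldType) (T L : finType) (C : T -> L) (f : T -> R) l :
  (forall x, f x <= 1) -> avg C f l <= 1.
Proof.
move=> f1; rewrite /avg; set k := #|_|.
have [->|k0] := eqVneq k 0%N; first by rewrite invr0 mulr0 ler01.
rewrite ler_pdivrMr ?ltr0n ?lt0n // mul1r.
apply: le_trans (ler_sum _ (fun x _ => f1 x)) _.
by rewrite sumr_const.
Qed.

Lemma energy_le (R : realFieldType) (T L : finType) (C : T -> L) (f : T -> R) :
  (forall x, 0 <= f x <= 1) -> energy C f <= #|T|%:R.
Proof.
move=> f01; rewrite /energy.
have -> : #|T|%:R = \sum_(x : T) (1 : R) by rewrite sumr_const.
apply: ler_sum => x _; rewrite exprn_ile1 //.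
  by apply: avg_ge0 => y; case/andP: (f01 y).
by apply: avg_le1 => y; case/andP: (f01 y).
Qed.

(** Pythagoras: the coarse average depends only on the fine colour, through [h], so [sum_avg]
    evaluates the cross term to the coarse energy. *)
Lemma energy_refine (R : realFieldType) (T L L' : finType) (C : T -> L)
    (C' : T -> L') (h : L' -> L) (f : T -> R) :
  (forall x, C x = h (C' x)) ->
  \sum_x (avg C' f (C' x) - avg C f (C x)) ^+ 2 = energy C' f - energy C f.
Proof.
move=> hC.
have cross : \sum_x avg C' f (C' x) * avg C f (C x) = energy C f.
  transitivity (\sum_x avg C' f (C' x) * avg C f (h (C' x))).
    by apply: eq_bigr => x _; rewrite -hC.
  rewrite (sum_avg C' f (fun l => avg C f (h l))).
  transitivity (\sum_x f x * avg C f (C x)).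
    by apply: eq_bigr => x _; rewrite -hC.
  by rewrite -sum_avg; apply: eq_bigr => x _; rewrite expr2.
transitivity (energy C' f - (\sum_x avg C' f (C' x) * avg C f (C x)) *+ 2
              + energy C f); last by rewrite cross; ring.
rewrite -sumrMnl -sumrB -big_split /=.
by apply: eq_bigr => x _; ring.
Qed.

(** * Irregular pairs and the energy increment *)

Definition pair_col (V K : finType) (c : V -> K) (p : V * V) : K * K :=
  (c p.1, c p.2).

Definition cell (V K : finType) (c : V -> K) (a : K) : {set V} :=
  [set x | c x == a].

(* Only the lower half of the usual regularity condition is recorded. *)
Definition irregularity (R : realFieldType) (V K : finType) (eps : R)
    (f : V * V -> R) (c : V -> K) (ab : K * K) (XY : {set V} * {set V}) : bool :=
  [&& XY.1 \subset cell c ab.1, XY.2 \subset cell c ab.2,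
      eps * #|cell c ab.1|%:R <= #|XY.1|%:R,
      eps * #|cell c ab.2|%:R <= #|XY.2|%:R
    & \sum_(p in setX XY.1 XY.2) f p
        < (avg (pair_col c) f ab - eps) * #|XY.1|%:R * #|XY.2|%:R].

Definition irregular (R : realFieldType) (V K : finType) (eps : R)
    (f : V * V -> R) (c : V -> K) (ab : K * K) : bool :=
  [exists XY, irregularity eps f c ab XY].

(** Counting pairs of vertices instead of cells weights each pair of cells by its sizes, so the
    partition need not be equitable. *)
Definition irregular_pairs (R : realFieldType) (V K : finType) (eps : R)
    (f : V * V -> R) (c : V -> K) : {set V * V} :=
  [set p | irregular eps f c (pair_col c p)].

(** All cells are split at once by the witnesses of irregularity. By [energy_refine] the gain is the
    sum of [D ^ 2]; an irregular pair of cells contributes at least [eps ^ 2 * #|X| * #|Y|], and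
    [X], [Y] fill an [eps] share of their cells. *)
Lemma energy_increment (R : realFieldType) (V K : finType) (eps : R)
    (f : V * V -> R) (c : V -> K) :
  0 < eps ->
  exists c' : V -> K * {ffun K * K -> bool * bool},
    energy (pair_col c) f + eps ^+ 4 * #|irregular_pairs eps f c|%:R
      <= energy (pair_col c') f.
Proof.
move=> eps0.
pose wit ab := odflt (set0, set0) [pick XY | irregularity eps f c ab XY].
have witP ab : irregular eps f c ab -> irregularity eps f c ab (wit ab).
  rewrite /wit; case: pickP => //= noXY /existsP[XY].
  by rewrite noXY.
pose c' x := (c x, [ffun ab => (x \in (wit ab).1, x \in (wit ab).2)]).
exists c'.
rewrite addrC -lerBrDr -(@energy_refine _ _ _ _ _ _
  (fun l => (l.1.1, l.2.1))) //.
set D := fun p => avg (pair_col c') f (pair_col c' p)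
                  - avg (pair_col c) f (pair_col c p).
rewrite -sum1_card natr_sum mulr_sumr.
rewrite (partition_big (pair_col c) predT) //=.
rewrite [leRHS](partition_big (pair_col c) predT) //=.
apply: ler_sum => ab _.
have [irr|reg] := boolP (irregular eps f c ab); last first.
  rewrite big_pred0; first by apply: sumr_ge0 => p _; exact: sqr_ge0.
  by move=> p; rewrite inE; case: eqP => [->|]; rewrite ?(negbTE reg) ?andbF.
have /and5P[] := witP _ irr; set X := (wit ab).1; set Y := (wit ab).2.
move=> XA YB Xbig Ybig low.
have inXY p : p \in setX X Y -> pair_col c p == ab.
  case: p => x y; rewrite in_setX => /andP[/= xX yY].
  move: (subsetP XA _ xX) (subsetP YB _ yY).
  rewrite !inE => /eqP cx /eqP cy.
  by rewrite /pair_col /= cx cy -surjective_pairing.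
have sumD : \sum_(p in setX X Y) D p < - eps * (#|X|%:R * #|Y|%:R).
  rewrite /D sumrB.
  have -> : \sum_(p in setX X Y) avg (pair_col c') f (pair_col c' p)
            = \sum_(p in setX X Y) f p.
    (* The indicator of [setX X Y], read off from the refined colours alone. *)
    pose g (l : (K * {ffun K * K -> bool * bool}) *
                (K * {ffun K * K -> bool * bool})) : R :=
      ((l.1.2 ab).1 && (l.2.2 ab).2)%:R.
    have gE p : g (pair_col c' p) = (p \in setX X Y)%:R.
      by case: p => x y; rewrite in_setX /g /= !ffunE.
    have ind (F : V * V -> R) :
        \sum_(p in setX X Y) F p = \sum_p F p * g (pair_col c' p).
      rewrite big_mkcond; apply: eq_bigr => p _; rewrite gE.
      by case: ifP; rewrite ?mulr1 ?mulr0.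
    by rewrite !ind sum_avg.
  have -> : \sum_(p in setX X Y) avg (pair_col c) f (pair_col c p)
            = avg (pair_col c) f ab * (#|X|%:R * #|Y|%:R).
    rewrite -natrM -cardsX mulr_natr -sumr_const.
    by apply: eq_bigr => p /inXY/eqP->.
  rewrite ltrBlDr.
  by apply: lt_le_trans low _; rewrite -mulrA mulrBl addrC mulNr.
apply: (@le_trans _ _ (eps ^+ 2 * (#|X|%:R * #|Y|%:R))).
  have cellE p : (p \in irregular_pairs eps f c) && (pair_col c p == ab)
                 = (p \in setX (cell c ab.1) (cell c ab.2)).
    case: p => x y; rewrite in_setX !inE /= -xpair_eqE -surjective_pairing.
    rewrite /pair_col /=; case: eqP => [->|_]; last by rewrite andbF.
    by rewrite irr.
  rewrite (eq_bigl _ _ cellE).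
  rewrite sumr_const cardsX mulr1 -[_ *+ (_ * _)]mulr_natr natrM.
  have -> : eps ^+ 4 * (#|cell c ab.1|%:R * #|cell c ab.2|%:R)
    = eps ^+ 2 * ((eps * #|cell c ab.1|%:R) * (eps * #|cell c ab.2|%:R)) :> R.
    by ring.
  by rewrite ler_wpM2l ?sqr_ge0 // ler_pM // mulr_ge0 ?ler0n ?ltW.
apply: (@le_trans _ _ (\sum_(p in setX X Y) D p ^+ 2)); last first.
  rewrite [leRHS](bigID (mem (setX X Y))) /=.
  rewrite (eq_bigl (mem (setX X Y)) (P1 := fun p => (_ == _) && _)).
    by rewrite lerDl; apply: sumr_ge0 => p _; exact: sqr_ge0.
  by move=> p /=; case: (boolP (p \in _)) => [/inXY->|]; rewrite ?andbF.
(* In place of Cauchy-Schwarz, [(D + eps) ^ 2 >= 0] bounds [D ^ 2] below by a linear expression,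
   which [sumD] controls. *)
apply: (@le_trans _ _ (\sum_(p in setX X Y) (- (eps * 2) * D p - eps ^+ 2))).
  rewrite sumrB -mulr_sumr sumr_const cardsX -[_ *+ (_ * _)]mulr_natr natrM.
  move: sumD; set S := \sum_(p in _) _; set m := _%:R * _ => sumD.
  have : eps * S <= eps * (- eps * m) by rewrite ler_pM2l // ltW.
  nra.
apply: ler_sum => p _.
have := sqr_ge0 (D p + eps); nra.
Qed.

(** A refinement adds to the old colour two membership bits for each of the [k * k] pairs of
    colours. *)
Fixpoint regularity_bound (j k : nat) : nat :=
  if j is i.+1 then regularity_bound i (k * 4 ^ (k * k))%N else k.

Lemma leq_regularity_bound j k : (k <= regularity_bound j k)%N.
Proof.
elim: j k => [|j IH] k //=; apply: leq_trans (IH _).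
by rewrite leq_pmulr // expn_gt0.
Qed.

(** [j] counts the refinements still allowed: each gains more than [eps ^ 5 * #|V| ^ 2], while the
    energy never exceeds [#|V| ^ 2]. *)
Lemma regularity_iteration (R : realFieldType) (V : finType) (eps : R)
    (f : V * V -> R) (j : nat) (K : finType) (c : V -> K) :
  0 < eps -> (0 < #|V|)%N -> (forall p, 0 <= f p <= 1) ->
  (1 - j%:R * eps ^+ 5) * #|V|%:R ^+ 2 <= energy (pair_col c) f ->
  exists (K' : finType) (c' : V -> K'),
    (#|K'| <= regularity_bound j #|K|)%N /\
    #|irregular_pairs eps f c'|%:R <= eps * #|V|%:R ^+ 2.
Proof.
move=> eps0 V0 f01.
have n0 : 0 < #|V|%:R ^+ 2 :> R by rewrite exprn_gt0 ?ltr0n.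
have e5 : 0 < eps ^+ 5 by rewrite exprn_gt0.
elim: j K c => [|j IH] K c low.
all: have [small|big] :=
  lerP #|irregular_pairs eps f c|%:R (eps * #|V|%:R ^+ 2);
  first by exists K, c; rewrite leq_regularity_bound.
all: have [c' inc] := energy_increment f c eps0.
all: have gain : eps ^+ 5 * #|V|%:R ^+ 2
               < eps ^+ 4 * #|irregular_pairs eps f c|%:R
  by rewrite exprSr -mulrA ltr_pM2l // exprn_gt0.
  (* For [j = 0] the energy is already maximal, so a further gain is absurd. *)
  have := energy_le (pair_col c') f01.
  rewrite card_prod natrM -expr2 => top.
  have : 0 < eps ^+ 5 * #|V|%:R ^+ 2 by rewrite mulr_gt0.
  move: low; rewrite mul0r subr0 mul1r; lra.
have [|K' [c'' [cK' cirr]]] := IH _ c'.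
  apply: le_trans inc; apply: le_trans (_ : _ <= energy (pair_col c) f
    + eps ^+ 5 * #|V|%:R ^+ 2) _; last by rewrite lerD2l ltW.
  by move: low; rewrite -natr1; lra.
exists K', c''; split => //; apply: leq_trans cK' _ => /=.
by rewrite card_prod card_ffun !card_prod card_bool.
Qed.

Lemma regularity (R : archiRealFieldType) (eps : R) :
  0 < eps ->
  exists M : nat, forall (V : finType) (f : V * V -> R),
    (forall p, 0 <= f p <= 1) ->
    exists (K : finType) (c : V -> K),
      (#|K| <= M)%N /\
      #|irregular_pairs eps f c|%:R <= eps * #|V|%:R ^+ 2.
Proof.
(* With [j * eps ^ 5 >= 1] the energy hypothesis of the iteration is trivial for a single colour. *)
move=> eps0; pose j := Num.bound (eps ^- 5).
exists (regularity_bound j 1) => V f f01.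
have [V0|V0] := posnP #|V|.
  exists unit, (fun=> tt); rewrite card_unit leq_regularity_bound; split=> //.
  rewrite V0 expr0n mulr0 (_ : #|_| = 0%N) //.
  by apply/eqP; rewrite -leqn0 (leq_trans (max_card _)) // card_prod V0.
have := @regularity_iteration R V eps f j unit (fun=> tt) eps0 V0 f01.
rewrite card_unit; apply; apply: (@le_trans _ _ 0).
  rewrite mulr_le0_ge0 ?exprn_ge0 ?ler0n // subr_le0.
  rewrite -ler_pdivrMr ?exprn_gt0 // mul1r ltW //.
  by apply: archi_boundP; rewrite invr_ge0 exprn_ge0 // ltW.
by apply: sumr_ge0 => p _; exact: sqr_ge0.
Qed.

(** * Cliques in linear families *)

Definition linear_family (V : finType) (BB : {set {set V}}) : Prop :=
  forall (B B' : {set V}) (x y : V), B \in BB -> B' \in BB -> x != y ->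
    x \in B -> y \in B -> x \in B' -> y \in B' -> B = B'.

Definition joined (V : finType) (BB : {set {set V}}) : rel V :=
  fun x y => (x != y) && [exists B in BB, (x \in B) && (y \in B)].

Lemma joined_sym (V : finType) (BB : {set {set V}}) : symmetric (joined BB).
Proof.
move=> x y; rewrite /joined eq_sym; congr (_ && _).
by apply: eq_existsb => B; rewrite [(x \in B) && _]andbC.
Qed.

(** The vertices forbidden to the next choice: those on a block through two vertices already
    chosen. *)
Definition spanned (V : finType) (BB : {set {set V}}) (vs : seq V) : {set V} :=
  \bigcup_(p in setX [set x in vs] [set x in vs])
    \bigcup_(B in BB | [&& p.1 != p.2, p.1 \in B & p.2 \in B]) B.

Lemma card_bigcup_leq (I : Type) (T : finType) (s : seq I) (P : pred I)
    (F : I -> {set T}) :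
  (#|\bigcup_(i <- s | P i) F i| <= \sum_(i <- s | P i) #|F i|)%N.
Proof.
elim/big_rec2: _ => [|i m A _ le]; first by rewrite cards0.
by apply: leq_trans (leq_card_setU _ _) _; rewrite leq_add2l.
Qed.

(** By linearity each pair of chosen vertices lies in at most one block. *)
Lemma card_spanned (V : finType) (BB : {set {set V}}) (t : nat) (vs : seq V) :
  linear_family BB -> (forall B, B \in BB -> (#|B| <= t)%N) ->
  (#|spanned BB vs| <= size vs ^ 2 * t)%N.
Proof.
move=> lin cB; apply: leq_trans (card_bigcup_leq _ _ _) _.
apply: (@leq_trans (\sum_(p in setX [set x in vs] [set x in vs]) t)).
  apply: leq_sum => p _.
  have [/existsP[B0 /and4P[B0B ne p1 p2]]|none] := boolP
    [exists B, [&& B \in BB, p.1 != p.2, p.1 \in B & p.2 \in B]].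
    apply: leq_trans (cB _ B0B); apply/subset_leq_card/bigcupsP => B.
    by case/and4P=> BB1 _ q1 q2; rewrite (lin _ _ _ _ BB1 B0B ne q1 q2 p1 p2).
  rewrite big_pred0 ?cards0 // => B; apply/negbTE; move: none.
  by rewrite negb_exists => /forallP.
have le : (#|[set x in vs]| <= size vs)%N by rewrite cardsE card_size.
by rewrite sum_nat_const leq_mul2r cardsX leq_mul ?orbT.
Qed.

(* The head of the list is the most recently chosen vertex. *)
Fixpoint generic_seq (V : finType) (BB : {set {set V}}) (vs : seq V) : bool :=
  if vs is v :: us then
    [&& v \notin spanned BB us, all (joined BB v) us & generic_seq BB us]
  else true.

Lemma generic_seq_joined (V : finType) (BB : {set {set V}}) (vs : seq V) :
  generic_seq BB vs ->
  uniq vs /\ {in vs &, forall x y, x != y -> joined BB x y}.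
Proof.
elim: vs => [|v us IH] //= /and3P[_ /allP vus /IH[-> us2]]; split.
  by rewrite andbT; apply/negP => /vus; rewrite /joined eqxx.
move=> x y; rewrite !inE => /orP[/eqP->|xu] /orP[/eqP->|yu]; rewrite ?eqxx //.
- by move=> _; exact: vus.
- by move=> _; rewrite joined_sym; exact: vus.
- exact: us2.
Qed.

(** Otherwise the vertex chosen last would lie in the span of the other two. *)
Lemma generic_seq_three (V : finType) (BB : {set {set V}}) (vs : seq V)
    (B : {set V}) (x y z : V) :
  generic_seq BB vs -> B \in BB -> x \in vs -> y \in vs -> z \in vs ->
  x != y -> y != z -> x != z -> ~~ [&& x \in B, y \in B & z \in B].
Proof.
move=> + BBB; elim: vs => [|v us IH] //= /and3P[vsp _ gus].
have no a b : a \in us -> b \in us -> a != b ->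
    ~~ [&& v \in B, a \in B & b \in B].
  move=> au bu ab; apply: contra vsp => /and3P[vB aB bB].
  apply/bigcupP; exists (a, b); first by rewrite in_setX !inE au.
  by apply/bigcupP; exists B => //=; rewrite BBB ab aB.
rewrite !inE => /orP[/eqP->|xu] /orP[/eqP->|yu] /orP[/eqP->|zu];
  rewrite ?eqxx // => xy yz xz.
- exact: no.
- by rewrite andbCA; apply: no => //; rewrite eq_sym.
- by rewrite andbA andbC; apply: no.
- exact: IH.
Qed.

(** * Greedy embedding of a clique *)

Definition lower_dense (R : realFieldType) (V : finType) (e : rel V)
    (eps beta : R) (A B : {set V}) : bool :=
  [forall X : {set V}, forall Y : {set V},
    [&& X \subset A, Y \subset B, eps * #|A|%:R <= #|X|%:R
      & eps * #|B|%:R <= #|Y|%:R] ==>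
    (beta * #|X|%:R * #|Y|%:R <= \sum_(p in setX X Y) (e p.1 p.2)%:R)].

Definition low_degree (R : realFieldType) (V : finType) (e : rel V) (beta : R)
    (C D : {set V}) : {set V} :=
  [set v in C | #|[set u in D | e v u]|%:R < beta * #|D|%:R].

(** If there were more of them, the set of low-degree vertices together with [D] would itself
    violate [lower_dense]. *)
Lemma card_low_degree (R : realFieldType) (V : finType) (e : rel V)
    (eps beta : R) (A B C D : {set V}) :
  lower_dense e eps beta A B -> C \subset A -> D \subset B ->
  0 < eps -> (0 < #|A|)%N -> eps * #|B|%:R <= #|D|%:R ->
  #|low_degree e beta C D|%:R <= eps * #|A|%:R.
Proof.
move=> den CA DB eps0 A0 Dbig; set X := low_degree _ _ _ _.
rewrite leNgt; apply/negP => Xbig.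
have XA : X \subset A.
  by apply: subset_trans CA; apply/subsetP => v; rewrite inE => /andP[].
move/forallP/(_ X)/forallP/(_ D): den; rewrite XA DB (ltW Xbig) Dbig /=.
apply/negP; rewrite -ltNge.
have -> : \sum_(p in setX X D) (e p.1 p.2)%:R
        = \sum_(v in X) #|[set u in D | e v u]|%:R :> R.
  rewrite (eq_bigl (fun p => (p.1 \in X) && (p.2 \in D))); last first.
    by case=> x y; rewrite in_setX.
  rewrite -(pair_big (mem X) (mem D) (fun x y => (e x y)%:R)) /=.
  apply: eq_bigr => v _; rewrite -sum1_card natr_sum.
  rewrite [LHS]big_mkcond [RHS]big_mkcond; apply: eq_bigr => u _.
  by rewrite !inE; case: (u \in D); case: (e v u).
have Xn0 : (0 < #|X|)%N.
  by rewrite -(ltr0n R) (le_lt_trans _ Xbig) // mulr_ge0 ?ler0n ?ltW.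
have -> : beta * #|X|%:R * #|D|%:R = \sum_(v in X) beta * #|D|%:R.
  by rewrite sumr_const -[RHS]mulr_natr mulrAC.
have [v0 v0X] := card_gt0P Xn0.
apply: ltr_sum => [|v]; last by rewrite inE => /andP[].
by apply/hasP; exists v0; rewrite ?mem_index_enum.
Qed.

(* Each pair of [l] is a cell with the subset of it that is still available
   after the vertices [vs] have been chosen. *)
Lemma greedy_embedding (R : realFieldType) (V : finType) (BB : {set {set V}})
    (t r : nat) (eps beta : R) (l : seq ({set V} * {set V})) (vs : seq V) :
  linear_family BB -> (forall B, B \in BB -> (#|B| <= t)%N) ->
  0 < eps -> 0 < beta -> beta <= 1 ->
  (size l + size vs)%N = r ->
  (forall p, p \in l -> [/\ p.2 \subset p.1,
     beta ^+ size vs * #|p.1|%:R <= #|p.2|%:R,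
     r%:R * eps * #|p.1|%:R + (r ^ 2 * t)%:R < beta ^+ r * #|p.1|%:R &
     {in p.2 & vs, forall v u, joined BB v u}]) ->
  pairwise (fun p q : {set V} * {set V} => lower_dense (joined BB) eps beta p.1 q.1) l ->
  generic_seq BB vs ->
  exists ws, size ws = r /\ generic_seq BB ws.
Proof.
move=> lin cB eps0 beta0 beta1.
have [k szl] : exists k, size l = k by exists (size l).
elim: k l vs szl => [|k IH] [|[A C] l] vs // szl szr inv.
  by exists vs; rewrite -szr.
rewrite [pairwise _ _]/= => /andP[/allP denA denl] gvs.
have [/= CA Cbig Abig Cvs] := inv (A, C) (mem_head _ _).
have sizevs : (size vs <= r)%N by rewrite -szr leq_addl.
have powr : beta ^+ r <= beta ^+ size vs by rewrite ler_wiXn2l // ltW.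
have r1 : (1 <= r)%N by rewrite -szr.
have A0 : (0 < #|A|)%N.
  rewrite lt0n; apply: contraTneq Abig => ->; rewrite !mulr0 add0r -leNgt.
  exact: ler0n.
(* The vertices of [C] unfit to be chosen next. They number at most [r * eps * #|A| + r ^ 2 * t],
   which by hypothesis is less than [#|C|]. *)
pose X := spanned BB vs :|: \bigcup_(q <- l) low_degree (joined BB) beta C q.2.
have [v vC vX] : exists2 v, v \in C & v \notin X.
  apply/exists_inP; rewrite -negb_forall_in; apply/negP => /forall_inP sub.
  have : (#|C| <= #|X|)%N by apply/subset_leq_card/subsetP.
  apply/negP; rewrite -ltnNge -(ltr_nat R).
  apply: (@le_lt_trans _ _ ((size vs ^ 2 * t)%:R
    + \sum_(q <- l) #|low_degree (joined BB) beta C q.2|%:R)).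
    rewrite -natr_sum -natrD ler_nat.
    apply: leq_trans (leq_card_setU _ _) _.
    by rewrite leq_add ?card_spanned ?card_bigcup_leq.
  apply: le_lt_trans (_ : r%:R * eps * #|A|%:R + (r ^ 2 * t)%:R < _); last first.
    apply: lt_le_trans Abig _; apply: le_trans Cbig.
    by rewrite ler_wpM2r ?ler0n.
  rewrite addrC lerD //; last first.
    by rewrite ler_nat leq_mul2r leq_sqr sizevs orbT.
  apply: (@le_trans _ _ (\sum_(q <- l) eps * #|A|%:R)).
    rewrite big_seq [leRHS]big_seq; apply: ler_sum => q ql.
    have [q21 qbig qmain _] := inv q (mem_behead (s := _ :: _) ql).
    apply: (card_low_degree (denA _ ql)) => //.
    (* [q.2] is large enough to test density: [eps <= r * eps], and the size hypothesis on [q.1]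
       compares this with [beta ^+ r]. *)
    apply: le_trans qbig; apply: le_trans (_ : beta ^+ r * #|q.1|%:R <= _);
      last by rewrite ler_wpM2r ?ler0n.
    apply: le_trans (ltW qmain).
    rewrite -[leLHS]addr0 lerD ?ler0n // -mulrA ler_peMl ?ler1n //.
    by rewrite mulr_ge0 ?ler0n ?ltW.
  rewrite big_const_seq count_predT iter_addr_0 -[_ *+ size l]mulr_natl -mulrA.
  rewrite ler_wpM2r ?ler_nat ?mulr_ge0 ?ler0n ?ltW //.
  by rewrite -szr /= addSn -addnS leq_addr.
move: vX; rewrite inE negb_or => /andP[vsp vlow].
have vdeg q : q \in l ->
    beta * #|q.2|%:R <= #|[set u in q.2 | joined BB v u]|%:R.
  move=> ql; rewrite leNgt; apply: contra vlow => low.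
  by rewrite bigcup_seq; apply/bigcupP; exists q; rewrite // inE vC.
(* Choosing [v] shrinks each remaining candidate set by at most a factor [beta]. *)
pose step (q : {set V} * {set V}) := (q.1, [set u in q.2 | joined BB v u]).
apply: (IH (map step l) (v :: vs)).
- by move: szl; rewrite size_map => -[].
- by rewrite size_map addnS -addSn.
- move=> _ /mapP[q ql ->].
  have [q21 qbig qmain qvs] := inv q (mem_behead (s := _ :: _) ql); split=> //=.
  + by apply: subset_trans q21; apply/subsetP => u; rewrite inE => /andP[].
  + apply: le_trans (vdeg _ ql); rewrite exprS -mulrA.
    by rewrite ler_wpM2l // ltW.
  + move=> u w; rewrite inE => /andP[uq vu]; rewrite inE => /orP[/eqP->|wvs].
      by rewrite joined_sym.
    exact: qvs.
- by rewrite pairwise_map.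
- by rewrite /= vsp gvs andbT; apply/allP => u uvs; exact: Cvs.
Qed.

(** * Discarding small, sparse and irregular pairs *)

Lemma card_small_cells (R : realFieldType) (V K : finType) (c : V -> K)
    (g : R) :
  0 <= g -> #|[set x | #|cell c (c x)|%:R < g]|%:R <= #|K|%:R * g.
Proof.
move=> g0; rewrite -sum1_card natr_sum (partition_big c predT) //=.
rewrite mulr_natl -sumr_const; apply: ler_sum => a _.
have [small|big] := ltrP #|cell c a|%:R g; last first.
  rewrite big_pred0 // => x; rewrite inE.
  by case: eqP => [->|]; rewrite ?andbF // ltNge big.
apply: le_trans (ltW small).
rewrite -natr_sum sum1_card ler_nat; apply/subset_leq_card/subsetP => x.
by rewrite !inE => /andP[_].
Qed.

Definition sparse_pairs (R : realFieldType) (V K : finType) (c : V -> K)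
    (e : rel V) (d : R) : {set V * V} :=
  [set p | e p.1 p.2 &&
     (avg (pair_col c) (fun p => (e p.1 p.2)%:R) (pair_col c p) < d)].

(** By [sum_avg] these edges may be counted by their cell averages, each of which is below [d]. *)
Lemma card_sparse_pairs (R : realFieldType) (V K : finType) (c : V -> K)
    (e : rel V) (d : R) :
  0 <= d -> #|sparse_pairs c e d|%:R <= d * #|V|%:R ^+ 2.
Proof.
move=> d0; pose f p : R := (e p.1 p.2)%:R.
pose g l : R := (avg (pair_col c) f l < d)%R%:R.
have -> : #|sparse_pairs c e d|%:R = \sum_p f p * g (pair_col c p).
  rewrite -sum1_card natr_sum big_mkcond; apply: eq_bigr => p _.
  by rewrite inE /f /g -natrM mulnb; case: (_ && _).
rewrite -sum_avg; apply: (@le_trans _ _ (\sum_(p : V * V) d)).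
  apply: ler_sum => p _; rewrite /g.
  by case: ltrP => [/ltW|]; rewrite ?mulr1 ?mulr0.
by rewrite sumr_const card_prod -natrX mulr_natr expnS expn1.
Qed.

Lemma lower_dense_cells (R : realFieldType) (V K : finType) (c : V -> K)
    (e : rel V) (eps beta : R) (a b : K) :
  eps <= beta ->
  ~~ irregular eps (fun p => (e p.1 p.2)%:R) c (a, b) ->
  beta *+ 2 <= avg (pair_col c) (fun p => (e p.1 p.2)%:R) (a, b) ->
  lower_dense e eps beta (cell c a) (cell c b).
Proof.
move=> epsb reg den; apply/forallP => X; apply/forallP => Y.
apply/implyP => /and4P[XA YB Xbig Ybig]; rewrite leNgt.
apply: contra reg => low; apply/existsP; exists (X, Y).
rewrite /irregularity /= XA YB Xbig Ybig /=; apply: lt_le_trans low _.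
rewrite !ler_wpM2r ?ler0n // lerBrDr; apply: le_trans den.
by rewrite mulr2n lerD2l.
Qed.

Lemma linear_family_clique (R : archiRealFieldType) (t r : nat) (delta : R) :
  0 < delta -> (2 <= r)%N -> (r <= t)%N ->
  exists N : nat, forall (V : finType) (BB : {set {set V}}),
    (N <= #|V|)%N -> linear_family BB -> (forall B, B \in BB -> #|B| = t) ->
    delta * #|V|%:R ^+ 2 < #|BB|%:R ->
    exists ws, size ws = r /\ generic_seq BB ws.
Proof.
move=> delta0 r2 rt.
(* The bad pairs will number at most [5 * beta * n ^ 2]: one share for irregular pairs, two for
   sparse ones, two for pairs meeting a small cell. *)
pose beta := Num.min delta 1 / 8.
have min0 : 0 < Num.min delta 1 by rewrite lt_min delta0 ltr01.
have beta0 : 0 < beta by rewrite divr_gt0 // ltr0n.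
have beta1 : beta <= 1.
  rewrite ler_pdivrMr ?ltr0n // mul1r ge_min; apply/orP; right.
  by rewrite ler1n.
have beta8 : 8 * beta <= delta.
  by rewrite mulrC divfK ?pnatr_eq0 // ge_min lexx.
have r0 : 0 < r%:R :> R by rewrite ltr0n (leq_trans _ r2).
(* Half of [beta ^+ r] pays for low degrees in the greedy embedding, the other half for the spanned
   vertices. *)
pose eps := beta ^+ r / (2 * r%:R).
have eps0 : 0 < eps by apply: divr_gt0; [exact: exprn_gt0 | exact: mulr_gt0].
have reps : r%:R * eps = beta ^+ r / 2.
  by rewrite /eps; field; rewrite gt_eqF.
have epsb : eps <= beta.
  have br : beta ^+ r <= beta.
    rewrite -[leRHS]expr1 ler_wiXn2l // ?ltW //.
    by rewrite (leq_trans _ r2).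
  have : 1 <= r%:R :> R by rewrite ler1n (leq_trans _ r2).
  nra.
have [M regM] := regularity eps0.
(* At most [M] cells of size below [gam * n] cover at most [beta * n] vertices; the successor keeps
   the denominator nonzero. *)
pose gam := beta / M.+1%:R.
have gam0 : 0 < gam by rewrite divr_gt0 ?ltr0n.
pose m := (r ^ 2 * t)%N.
exists (Num.bound (m%:R / (gam * (beta ^+ r / 2)))).+1 => V BB Vbig lin cB BBbig.
set n := #|V| in Vbig BBbig.
have n0 : (0 < n)%N by apply: leq_trans Vbig.
have nR : 0 < n%:R :> R by rewrite ltr0n.
have gambig : m%:R < beta ^+ r / 2 * (gam * n%:R).
  have br0 : 0 < beta ^+ r / 2 by rewrite divr_gt0 ?exprn_gt0 ?ltr0n.
  have : m%:R / (gam * (beta ^+ r / 2)) < n%:R.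
    apply: lt_trans (archi_boundP _) _; last by rewrite ltr_nat.
    by rewrite divr_ge0 ?ler0n // mulr_ge0 // ltW.
  have gb0 : 0 < gam * (beta ^+ r / 2) by exact: mulr_gt0.
  by rewrite ltr_pdivrMr // mulrCA mulrA mulrC.
pose e := joined BB.
pose f (p : V * V) : R := (e p.1 p.2)%:R.
have [|K [c [cK irr]]] := regM V f.
  by move=> p; rewrite /f; case: (e _ _); rewrite ?ler01 ?lexx.
pose S := [set x | #|cell c (c x)|%:R < gam * n%:R].
pose bad := irregular_pairs eps f c :|: sparse_pairs c e (beta *+ 2)
  :|: setX S setT :|: setX setT S.
have cS : #|S|%:R <= beta * n%:R.
  apply: le_trans (card_small_cells _ _) _; first by rewrite mulr_ge0 ?ler0n ?ltW.
  rewrite mulrA ler_wpM2r ?ler0n // /gam mulrCA ger_pMr // ler_pdivrMr ?ltr0n //.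
  by rewrite mul1r ler_nat ltnW.
have cbad : #|bad|%:R < delta * n%:R ^+ 2.
  have : (#|bad| <= #|irregular_pairs eps f c|
          + #|sparse_pairs c e (beta *+ 2)| + #|S| * n + n * #|S|)%N.
    do 2!(apply: leq_trans (leq_card_setU _ _) _;
      apply: leq_add; last by rewrite cardsX cardsT).
    exact: leq_card_setU.
  rewrite -(ler_nat R) !natrD !natrM => le; apply: le_lt_trans le _.
  have b2 : 0 <= beta *+ 2 by rewrite mulrn_wge0 // ltW.
  have := card_sparse_pairs c e b2; rewrite -/n => sp.
  have n2 : 0 < n%:R ^+ 2 :> R by rewrite exprn_gt0.
  have : #|S|%:R * n%:R <= beta * n%:R ^+ 2.
    by rewrite expr2 mulrA ler_wpM2r ?ler0n.
  have : eps * n%:R ^+ 2 <= beta * n%:R ^+ 2 by rewrite ler_pM2r.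
  have : 8 * beta * n%:R ^+ 2 <= delta * n%:R ^+ 2 by rewrite ler_pM2r.
  have : 0 < beta * n%:R ^+ 2 by rewrite mulr_gt0.
  move: irr sp; rewrite -/n mulr2n; lra.
(* Otherwise each block contains a bad pair, and by linearity that pair determines the block, so the
   blocks are at most as many as the bad pairs. *)
have [B BBB good] : exists2 B, B \in BB &
    {in B &, forall x y, x != y -> (x, y) \notin bad}.
  have [/exists_inP[B BBB /forall_inP good]|none] := boolP
    [exists B in BB, [forall x in B, [forall y in B,
      (x != y) ==> ((x, y) \notin bad)]]].
    by exists B => // x y /good/forall_inP gx /gx/implyP.
  pose h (B : {set V}) :=
    [pick p : V * V | [&& p \in bad, p.1 != p.2, p.1 \in B & p.2 \in B]].
  have hP B : B \in BB -> exists p, [/\ h B = Some p, p \in bad, p.1 != p.2,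
      p.1 \in B & p.2 \in B].
    move=> BBB; rewrite /h; case: pickP => [p /and4P[? ? ? ?]|no].
      by exists p.
    case/negP: none; apply/exists_inP; exists B => //.
    apply/forall_inP => x xB; apply/forall_inP => y yB; apply/implyP => xy.
    by apply/negP => xybad; have := no (x, y); rewrite /= xybad xy xB yB.
  have hinj : {in BB &, injective h}.
    move=> B B' /[dup] BBB /hP[p [-> _ ne pB qB]] /[dup] BBB' /hP[p' [-> _ _]].
    by move=> + + [pp']; rewrite -pp' => pB' qB'; exact: (lin _ _ p.1 p.2).
  suff : (#|BB| <= #|bad|)%N.
    by rewrite -(ler_nat R) leNgt (lt_trans cbad BBbig).
  rewrite -(card_in_imset hinj) -(card_imset (mem bad) (@Some_inj _)).
  apply/subset_leq_card/subsetP => _ /imsetP[B /hP[p [-> pbad _ _ _]] ->].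
  exact: imset_f.
have good2 x y : x \in B -> y \in B -> x != y ->
    [/\ lower_dense e eps beta (cell c (c x)) (cell c (c y)),
        x \notin S & y \notin S].
  move=> xB yB xy; have := good x y xB yB xy.
  rewrite /bad !in_setU !in_setX !in_setT andbT /= !negb_or.
  move=> /andP[/andP[/andP[reg dens] xS] yS]; split=> //.
  apply: lower_dense_cells epsb _ _; first by move: reg; rewrite inE.
  (* Points of a block are joined, so a pair outside [sparse_pairs] must have a dense pair of
     cells. *)
  move: dens; rewrite inE negb_and -leNgt /= => /orP[/negP[]|//].
  by rewrite /e /joined xy; apply/exists_inP; exists B; rewrite ?xB.
pose ws := take r (enum B).
have wsB x : x \in ws -> x \in B by move=> /mem_take; rewrite mem_enum.
have sws : size ws = r.
  by rewrite size_takel // -cardE cB.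
have uws : uniq ws by rewrite take_uniq // enum_uniq.
(* At the start whole cells are available. Cells of different [x] may coincide; the chosen vertices
   are distinct because they are joined. *)
apply: (@greedy_embedding R V BB t r eps beta
  [seq (cell c (c x), cell c (c x)) | x <- ws] [::]) => //.
- by move=> B' /cB->.
- by rewrite size_map addn0.
- move=> _ /mapP[x xws ->] /=; split=> //; first by rewrite expr0 mul1r.
  have xS : x \notin S.
    have [y yB yx] : exists2 y, y \in B & y != x.
      have : (0 < #|B :\ x|)%N.
        have := cardsD1 x B; rewrite cB // wsB // add1n => tE.
        by rewrite -ltnS -tE (leq_trans r2).
      by case/card_gt0P=> y; rewrite !inE => /andP[yx yB]; exists y.
    by have [] := good2 _ _ yB (wsB _ xws) yx.
  move: xS; rewrite inE -leNgt => xbig.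
  rewrite reps [X in _ < X]( _ : _ = beta ^+ r / 2 * #|cell c (c x)|%:R
    + beta ^+ r / 2 * #|cell c (c x)|%:R); last by field.
  rewrite ltrD2l; apply: lt_le_trans gambig _.
  by rewrite ler_wpM2l // divr_ge0 ?exprn_ge0 ?ltW // ltW ?ltr0n.
- rewrite pairwise_map.
  apply: (@sub_in_pairwise _ (mem ws) [rel x y | x != y]) => /=.
  + by move=> x y xws yws /= xy; have [] := good2 _ _ (wsB _ xws) (wsB _ yws) xy.
  + by apply/allP.
  + by rewrite -uniq_pairwise.
Qed.

(** * Packings without rainbow triangles *)

Lemma mem_edges_image (F : sgraph) (n : nat) (f : {ffun F -> 'I_n})
    (a b : 'I_n) :
  [set a; b] \in edges (image_graph f) ->
  exists u v : F, [/\ adj u v, a = f u & b = f v].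
Proof.
case/imsetP=> -[u v]; rewrite inE /= => uv eab.
have : a \in [set f u; f v] by rewrite -eab set21.
have : b \in [set f u; f v] by rewrite -eab set22.
have fu : f u \in [set a; b] by rewrite eab set21.
have fv : f v \in [set a; b] by rewrite eab set22.
(* [f] need not be injective here: in the first and last cases [a = b], and the other image must
   equal them too. *)
rewrite !in_set2 => /orP[/eqP bE|/eqP bE] /orP[/eqP aE|/eqP aE].
- exists u, v; split=> //; subst a b; move: fv.
  by rewrite !in_set2 orbb => /eqP.
- by exists v, u; split=> //; rewrite adj_sym.
- by exists u, v.
- exists u, v; split=> //; subst a b; move: fu.
  by rewrite !in_set2 orbb => /eqP.
Qed.

Lemma edge_image (F : sgraph) (n : nat) (f : {ffun F -> 'I_n}) (u v : F) :
  adj u v -> [set f u; f v] \in edges (image_graph f).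
Proof. by move=> uv; apply/imsetP; exists (u, v); rewrite ?inE. Qed.

Lemma adj_neq (F : sgraph) (u v : F) : adj u v -> u != v.
Proof. by apply: contraTneq => ->; rewrite adj_irrefl. Qed.

(** A rainbow [G] contains a rainbow triangle. Disjoint vertex classes match up the endpoints of its
    three edges, so the triangle hypothesis puts two edges into one copy. *)
Lemma packing_lower_bound (F G : sgraph) (n : nat) (P : finType) (S : {set P})
    (phi : P -> F -> 'I_n) :
  girth3 F -> girth3 G ->
  (forall p q u v, phi p u = phi q v -> u = v) ->
  (forall p q u v, p \in S -> q \in S -> u != v ->
     phi p u = phi q u -> phi p v = phi q v -> p = q) ->
  (forall p q r u v w, p \in S -> q \in S -> r \in S ->
     u != v -> v != w -> w != u ->
     phi p v = phi q v -> phi q w = phi r w -> phi r u = phi p u -> p = q) ->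
  (#|S| <= multicolor_ex F n G)%N.
Proof.
move=> [u0 [v0 [_ [uv0 _ _]]]] [x [y [z [xy yz zx]]]] part lin tri.
pose copy p := image_graph (finfun (phi p)).
have edgeP p a b : [set a; b] \in edges (copy p) ->
    exists u v, [/\ adj u v, a = phi p u & b = phi p v].
  by case/mem_edges_image=> u [v []]; rewrite !ffunE => *; exists u, v.
have edgeI p u v : adj u v -> [set phi p u; phi p v] \in edges (copy p).
  by move/(edge_image (finfun (phi p))); rewrite !ffunE.
have shared p q e : p \in S -> q \in S -> e \in edges (copy p) ->
    e \in edges (copy q) -> p = q.
  move=> pS qS /imsetP[-[u v]]; rewrite inE /= => uv ->; rewrite !ffunE.
  case/edgeP=> u' [v' [_ eu ev]].
  by apply: (lin p q u v pS qS (adj_neq uv));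
    [rewrite {2}(part _ _ _ _ eu)|rewrite {2}(part _ _ _ _ ev)].
have copyinj : {in S &, injective copy}.
  by move=> p q pS qS E; apply: (shared p q _ pS qS (edgeI p _ _ uv0));
    rewrite -E; exact: edgeI.
pose A := [set copy p | p in S].
rewrite -(card_in_imset copyinj) -/A.
apply: (@leq_bigmax_cond _ _ (fun A : {set subgraph n} => #|A|) A).
apply/andP; split; first (apply/andP; split).
- apply/forall_inP => _ /imsetP[p _ ->]; apply/existsP.
  exists (finfun (phi p)); rewrite eqxx andbT; apply/injectiveP => u v.
  by rewrite !ffunE => /part.
- apply/forall_inP => _ /imsetP[p pS ->].
  apply/forall_inP => _ /imsetP[q qS ->]; apply/implyP => pq.
  rewrite disjoint_subset; apply/subsetP => e ep; rewrite !inE.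
  by apply: contra pq => eq; rewrite (shared p q e).
apply/negP => /existsP[K /andP[/existsP[g /andP[/injectiveP ginj /eqP ->]]]].
case/andP=> /subsetP cover /forall_inP rain.
have get u v : adj u v -> exists p, [/\ p \in S,
    [set g u; g v] \in edges (copy p) & exists u' v',
    [/\ u' != v', g u = phi p u' & g v = phi p v']].
  move=> uv.
  have /bigcupP[_ /imsetP[p pS ->] ep] := cover _ (edge_image g uv).
  by exists p; split=> //; have [u' [v' [/adj_neq ? ? ?]]] := edgeP _ _ _ ep;
    exists u', v'.
have [p [pS ep [u [v [uv pu pv]]]]] := get _ _ xy.
have [q [qS eq [v' [w [vw qv qw]]]]] := get _ _ yz.
have [r [rS _ [w' [u' [wu rw ru]]]]] := get _ _ zx.
have vE : v' = v by apply: (part q p); rewrite -qv.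
have wE : w' = w by apply: (part r q); rewrite -rw.
have uE : u' = u by apply: (part r p); rewrite -ru.
subst v' w' u'.
have pq : p = q by apply: (tri p q r u v w) => //; congruence.
move: (rain _ (edge_image g xy)) => /forall_inP /(_ _ (edge_image g yz)).
have ne : [set g x; g y] != [set g y; g z].
  apply/eqP => E; have := set21 (g x) (g y); rewrite E in_set2 !(inj_eq ginj).
  rewrite (negbTE (adj_neq xy)) /= => /eqP xz.
  by move: (adj_neq zx); rewrite xz eqxx.
rewrite ne => /forall_inP /(_ (copy p)) /(_ (imset_f _ pS)).
move=> /forall_inP /(_ (copy q)) /(_ (imset_f _ qS)).
by rewrite ep eq -pq eqxx.
Qed.

(** * Behrend's construction in a box *)

(** Squaring [ga * c = - (al * a + be * b)] expresses [al * be * |b - a| ^ 2] through differences of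
    squared norms, all zero on a sphere. *)
Lemma sphere_strictly_convex (m : nat) (a b c : 'I_m -> int)
    (al be ga : int) :
  al + be + ga = 0 -> al != 0 -> be != 0 ->
  (forall k, al * a k + be * b k + ga * c k = 0) ->
  \sum_k a k ^+ 2 = \sum_k b k ^+ 2 -> \sum_k a k ^+ 2 = \sum_k c k ^+ 2 ->
  a =1 b.
Proof.
move=> s0 al0 be0 comb ab ac k.
have sum0 : \sum_k (b k - a k) ^+ 2 = 0.
  apply: (@mulfI _ (al * be)); first by rewrite mulf_neq0.
  rewrite mulr0 mulr_sumr.
  transitivity (\sum_k (- (ga * be) * (b k ^+ 2 - a k ^+ 2)
                        - ga ^+ 2 * (c k ^+ 2 - a k ^+ 2))).
    apply: eq_bigr => i _.
    have -> : ga ^+ 2 * (c i ^+ 2 - a i ^+ 2)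
              = (al * a i + be * b i) ^+ 2 - ga ^+ 2 * a i ^+ 2.
      have -> : al * a i + be * b i = - (ga * c i).
        by apply/eqP; rewrite -addr_eq0 comb.
      ring.
    have -> : ga = - (al + be) by apply/eqP; rewrite -addr_eq0 addrC s0.
    ring.
  rewrite sumrB -!mulr_sumr !sumrB ab -ac ab; ring.
have := psumr_eq0P (fun i _ => sqr_ge0 (b i - a i)) sum0 (i := k) isT.
by move/eqP; rewrite sqrf_eq0 subr_eq0 => /eqP.
Qed.

Definition norm2 (m D : nat) (a : {ffun 'I_m -> 'I_D}) : nat :=
  (\sum_k a k ^ 2)%N.

(** Pigeonhole: the squared norm is at most [m * D ^ 2]. *)
Lemma popular_sphere (m D : nat) :
  exists rho, (D ^ m <= (m * D ^ 2).+1
    * #|[set a : {ffun 'I_m -> 'I_D} | norm2 a == rho]|)%N.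
Proof.
pose N := (m * D ^ 2)%N.
have norm_lt a : (norm2 (a : {ffun 'I_m -> 'I_D}) < N.+1)%N.
  rewrite ltnS /N -[X in (_ <= X * _)%N]card_ord -sum_nat_const.
  by apply: leq_sum => k _; rewrite leq_sqr ltnW.
pose c (i : 'I_N.+1) :=
  #|[set a : {ffun 'I_m -> 'I_D} | norm2 a == val i]|.
have [i0 maxi] : {i0 | (\max_i c i)%N = c i0}.
  by apply: (bigop.eq_bigmax c); rewrite card_ord.
exists (val i0); rewrite -[#|_|]/(c i0) -maxi.
have -> : (D ^ m = \sum_(i < N.+1) c i)%N.
  rewrite -{1}[D]card_ord -{1}[m]card_ord -card_ffun -sum1_card.
  rewrite (partition_big (fun a => Ordinal (norm_lt a)) predT) //=.
  apply: eq_bigr => i _; rewrite /c -sum1_card; apply: eq_bigl => a.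
  by rewrite inE -val_eqE.
rewrite -/N -[X in (_ <= X * _)%N]card_ord -sum_nat_const.
by apply: leq_sum => i _; exact: leq_bigmax.
Qed.

(* [p = (x, a)] stands for the progression [x, x + a, x + 2 a, ...], one term
   in each of the [#|F|] vertex classes. *)
Definition progression_copy (F : sgraph) (m D : nat)
    (p : {ffun 'I_m -> 'I_D} * {ffun 'I_m -> 'I_D}) (v : F) :
    F * {ffun 'I_m -> 'I_(#|F| * D).+1} :=
  (v, [ffun i => inord (p.1 i + enum_rank v * p.2 i)]).

(** All coordinates are at most [#|F| * D], so [inord] does not truncate. *)
Lemma progression_copy_eq (F : sgraph) (m D : nat)
    (p q : {ffun 'I_m -> 'I_D} * {ffun 'I_m -> 'I_D}) (v : F) :
  progression_copy p v = progression_copy q v ->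
  forall i, (p.1 i + enum_rank v * p.2 i = q.1 i + enum_rank v * q.2 i)%N.
Proof.
have bound (p' : {ffun 'I_m -> 'I_D} * {ffun 'I_m -> 'I_D}) i :
    (p'.1 i + enum_rank v * p'.2 i < (#|F| * D).+1)%N.
  rewrite ltnS; apply: leq_trans (_ : (enum_rank v).+1 * D <= _)%N.
    by rewrite mulSn leq_add ?leq_mul // ltnW.
  by rewrite leq_mul2r ltn_ord orbT.
case=> /ffunP E i; have := E i; rewrite !ffunE => /(congr1 val).
by rewrite /= !inordK.
Qed.

Lemma progression_copy_inj (F : sgraph) (m D : nat)
    (p q : {ffun 'I_m -> 'I_D} * {ffun 'I_m -> 'I_D}) (u v : F) :
  u != v -> progression_copy p u = progression_copy q u ->
  progression_copy p v = progression_copy q v -> p = q.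
Proof.
move=> uv /progression_copy_eq Eu /progression_copy_eq Ev.
have ruv : enum_rank u != enum_rank v :> nat.
  by rewrite val_eqE (inj_eq enum_rank_inj).
case: p q Eu Ev => x a [y b] /= Eu Ev.
have ab i : a i = b i :> nat.
  have : ((enum_rank u)%:Z - (enum_rank v)%:Z) * ((a i)%:Z - (b i)%:Z) = 0.
    have := congr1 Posz (Eu i); have := congr1 Posz (Ev i).
    rewrite !PoszD !PoszM; lra.
  move/eqP; rewrite mulf_eq0 !subr_eq0 !eqz_nat (negbTE ruv) /=.
  by move/eqP.
congr pair; apply/ffunP => i; apply: val_inj => //=.
by have := Eu i; rewrite ab => /addIn.
Qed.

(** Adding the three incidences cancels the starting points and leaves a relation between the
    differences, with coefficients [u - v], [v - w], [w - u] in ranks. Strict convexity gives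
    [p.2 = q.2], and the common point then gives [p.1 = q.1]. *)
Lemma progression_copy_triangle (F : sgraph) (m D rho : nat)
    (p q r : {ffun 'I_m -> 'I_D} * {ffun 'I_m -> 'I_D}) (u v w : F) :
  norm2 p.2 = rho -> norm2 q.2 = rho -> norm2 r.2 = rho ->
  u != v -> v != w -> w != u ->
  progression_copy p v = progression_copy q v ->
  progression_copy q w = progression_copy r w ->
  progression_copy r u = progression_copy p u -> p = q.
Proof.
move=> np nq nr uv vw wu Ev Ew Eu.
have rank_neq (x y : F) :
    x != y -> ((enum_rank x)%:Z - (enum_rank y)%:Z != 0).
  by rewrite subr_eq0 eqz_nat val_eqE (inj_eq enum_rank_inj).
have normZ (a : {ffun 'I_m -> 'I_D}) :
    \sum_k (a k)%:Z ^+ 2 = (norm2 a)%:Z.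
  rewrite /norm2 -[RHS]natz natr_sum; apply: eq_bigr => k _.
  by rewrite natrX natz.
have pq2 : (fun k => (p.2 k)%:Z) =1 (fun k => (q.2 k)%:Z).
  apply: (@sphere_strictly_convex m _ _ (fun k => (r.2 k)%:Z)
    ((enum_rank u)%:Z - (enum_rank v)%:Z) ((enum_rank v)%:Z - (enum_rank w)%:Z)
    ((enum_rank w)%:Z - (enum_rank u)%:Z)).
  - ring.
  - exact: rank_neq.
  - exact: rank_neq.
  - move=> k; have := progression_copy_eq Eu k.
    have := progression_copy_eq Ev k; have := progression_copy_eq Ew k.
    move=> /(congr1 Posz) + /(congr1 Posz) + /(congr1 Posz).
    rewrite !PoszD !PoszM; lra.
  - by rewrite !normZ np nq.
  - by rewrite !normZ np nr.
case: p q pq2 Ev {np nq Ew Eu} => x a [y b] /= ab Ev.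
have abE : a = b by apply/ffunP => k; apply: val_inj; case: (ab k).
congr pair => //; apply/ffunP => k; apply: val_inj => /=.
by have := progression_copy_eq Ev k; rewrite /= abE => /addIn.
Qed.

(** In dimension [s - k] the host has at most [2 ^ (k + (k + s) * (s - k))] vertices, and this
    exponent is [s ^ 2 - k ^ 2 + k]. The factor [2 ^ (3 * s)] bounds the number [m * D ^ 2 + 1] of
    spheres. *)
Lemma multicolor_ex_pow2 (F G : sgraph) (n s : nat) :
  girth3 F -> girth3 G -> (#|F| <= s)%N -> (2 ^ s ^ 2 <= n)%N ->
  (2 ^ (2 * s * (s - #|F|)) <= multicolor_ex F n G * 2 ^ (3 * s))%N.
Proof.
move=> gF gG; set k := #|F| => ks ns.
pose m := (s - k)%N; pose D := (2 ^ s)%N.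
pose W := (F * {ffun 'I_m -> 'I_(k * D).+1})%type.
have [u0 _] := gF.
have k0 : (0 < k)%N by apply/card_gt0P; exists u0.
have kD : ((k * D).+1 <= 2 ^ (k + s))%N.
  rewrite expnD; apply: leq_trans (_ : k.+1 * D <= _)%N.
    by rewrite mulSn -[X in (X <= _)%N]add1n leq_add2r !expn_gt0.
  by rewrite leq_mul2r ltn_expl ?orbT.
have cW : (#|{: W}| <= n)%N.
  apply: leq_trans ns; rewrite card_prod card_ffun !card_ord -/k.
  apply: leq_trans (_ : 2 ^ k * (2 ^ (k + s)) ^ m <= _)%N.
    apply: leq_mul; first by rewrite ltnW // ltn_expl.
    by have [->|m0] := posnP m; rewrite ?expn0 // leq_exp2r.
  rewrite -expnM -expnD leq_exp2l // /m.
  have -> : ((k + s) * (s - k) = s ^ 2 - k ^ 2)%N.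
    by rewrite subn_sqr mulnC addnC.
  have : (k <= k ^ 2)%N by rewrite expnS expn1 leq_pmulr.
  have : (k ^ 2 <= s ^ 2)%N by rewrite leq_sqr.
  lia.
pose emb (x : W) : 'I_n := widen_ord cW (enum_rank x).
have emb_inj : injective emb.
  by move=> x y /(congr1 val) /= /val_inj /enum_rank_inj.
have [rho rhoP] := popular_sphere m D.
pose S := [set p : {ffun 'I_m -> 'I_D} * {ffun 'I_m -> 'I_D} | norm2 p.2 == rho].
have cS : (#|S| <= multicolor_ex F n G)%N.
  apply: (@packing_lower_bound F G n _ S (fun p v => emb (progression_copy p v)))
    => //.
  - by move=> p q u v /emb_inj [].
  - move=> p q u v _ _ uv /emb_inj Eu /emb_inj Ev.
    exact: progression_copy_inj uv Eu Ev.
  - move=> p q r u v w; rewrite !inE => /eqP np /eqP nq /eqP nr uv vw wu.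
    move=> /emb_inj Ev /emb_inj Ew /emb_inj Eu.
    exact: (progression_copy_triangle np nq nr uv vw wu Ev Ew Eu).
have SE : #|S| = (D ^ m * #|[set a : {ffun 'I_m -> 'I_D} | norm2 a == rho]|)%N.
  have -> : S = setX [set: {ffun 'I_m -> 'I_D}] [set a | norm2 a == rho].
    by apply/setP => -[x a]; rewrite in_setX !inE.
  by rewrite cardsX cardsT card_ffun !card_ord.
apply: leq_trans (leq_mul cS (leqnn _)); rewrite SE.
have -> : (2 ^ (2 * s * (s - k)) = D ^ m * D ^ m)%N.
  by rewrite /D -expnM -expnD -/m addnn -mul2n mulnA.
rewrite -mulnA leq_mul2l; apply/orP; right; apply: leq_trans rhoP _.
rewrite mulnC leq_mul2l; apply/orP; right.
have -> : (2 ^ (3 * s) = 2 ^ s * D ^ 2)%N.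
  by rewrite /D -expnM -expnD; congr (_ ^ _)%N; lia.
apply: leq_trans (_ : m.+1 * D ^ 2 <= _)%N.
  by rewrite mulSn -[X in (X <= _)%N]add1n leq_add2r !expn_gt0.
rewrite leq_mul2r; apply/orP; right; apply: leq_ltn_trans (ltn_expl s _) => //.
exact: leq_subr.
Qed.

Lemma multicolor_ex_lower (F G : sgraph) :
  girth3 F -> girth3 G ->
  exists n0, forall n, (n0 <= n)%N -> exists s, (2 ^ s ^ 2 <= n)%N /\
    (n ^ 2 <= multicolor_ex F n G * 2 ^ ((2 * #|F| + 9) * s))%N.
Proof.
move=> gF gG; set k := #|F|.
have k0 : (0 < k)%N by have [u0 _] := gF; apply/card_gt0P; exists u0.
exists (2 ^ k ^ 2)%N => n nbig.
(* Taking [s] maximal costs only [2 ^ O(s)], as [(s + 1) ^ 2] exceeds [s ^ 2] by [2 * s + 1]; the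
   choice of threshold gives [k <= s]. *)
have [s /= slow smax] : exists2 s, (2 ^ s ^ 2 <= n)%N & (n < 2 ^ s.+1 ^ 2)%N.
  have ex0 : exists s, (2 ^ s ^ 2 <= n)%N by exists k.
  have bnd s : (2 ^ s ^ 2 <= n)%N -> (s <= n)%N.
    apply: leq_trans; apply: ltnW; apply: leq_ltn_trans (ltn_expl (s ^ 2) _) => //.
    by rewrite expnS expn1; case: s => // s; rewrite leq_pmulr.
  case: (ex_maxnP ex0 bnd) => s slow smax; exists s => //.
  by rewrite ltnNge; apply/negP => /smax; rewrite ltnn.
exists s; split=> //.
have ks : (k <= s)%N.
  have := leq_ltn_trans nbig smax.
  by rewrite ltn_exp2l // ltn_sqr ltnS.
have s0 : (0 < s)%N by apply: leq_trans ks.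
have low := multicolor_ex_pow2 gF gG ks slow.
(* The first exponent sum is [2 * (s + 1) ^ 2]. The excess [2 * k * s + 4 * s + 2], with the earlier
   loss [3 * s], is at most [(2 * k + 9) * s] since [s >= 1]. *)
apply: (@leq_trans (2 ^ (2 * s * (s - k)) * 2 ^ (2 * k * s + 4 * s + 2))%N).
  rewrite -expnD; apply: leq_trans (_ : (2 ^ s.+1 ^ 2) ^ 2 <= _)%N.
    by rewrite leq_sqr ltnW.
  rewrite -expnM leq_exp2l // -mulnn.
  have : (2 * s * (s - k) + 2 * k * s = 2 * (s * s))%N.
    have := subnK ks; move: (s - k)%N => d; nia.
  by move=> E; lia.
apply: leq_trans (leq_mul low (leqnn _)) _.
rewrite -mulnA leq_mul2l -expnD leq_exp2l //; apply/orP; right.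
by rewrite -/k; move: (2 * k)%N => c; lia.
Qed.

(** * The two bounds for multicolor_ex *)

Lemma near_quadratic_multicolor_ex (R : realType) (F G : sgraph) :
  girth3 F -> girth3 G -> near_quadratic_lower R (fun n => multicolor_ex F n G).
Proof.
move=> gF gG; have [n0 low] := multicolor_ex_lower gF gG.
pose c : R := (2 * #|F| + 9)%:R.
exists (fun n => c * Num.sqrt (ln n%:R)).
  by apply/eqOP; near=> k; near=> n; rewrite normrM (ger0_norm (ler0n _ _));
    rewrite ler_wpM2r.
exists n0.+1 => // n /= nbig; have [s [sn nle]] := low n (ltnW nbig).
have npos : 0 < n%:R :> R by rewrite ltr0n (leq_trans _ nbig).
(* From [ln 2 <= 1] and [2 ^ s ^ 2 <= n]: [(s * ln 2) ^ 2 <= s ^ 2 * ln 2 <= ln n]. *)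
have s_sqrt : s%:R * ln 2 <= Num.sqrt (ln n%:R) :> R.
  have ln2_ge0 : 0 <= ln 2 :> R by rewrite ln_ge0 // ler1n.
  have ln2_le1 : ln 2 <= 1 :> R.
    rewrite -[leRHS]expRK ler_ln ?posrE ?expR_gt0 //.
    by apply: le_trans (expR_ge1Dx 1); lra.
  rewrite -[leLHS]ger0_norm ?mulr_ge0 // -sqrtr_sqr ler_wsqrtr //.
  apply: (@le_trans _ _ (s%:R ^+ 2 * ln 2)).
    by rewrite exprMn ler_wpM2l ?sqr_ge0 // expr2 ler_piMr.
  rewrite -natrX mulr_natl -lnXn // ler_ln ?posrE ?exprn_gt0 //.
  by rewrite -natrX ler_nat.
rewrite expRN ler_pdivrMr ?expR_gt0 //.
apply: (@le_trans _ _ ((multicolor_ex F n G)%:R * 2 ^+ ((2 * #|F| + 9) * s))).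
  by rewrite -!natrX -natrM ler_nat.
rewrite ler_wpM2l // -[2 ^+ _]lnK ?posrE ?exprn_gt0 // ler_expR lnXn //.
by rewrite -[leLHS]mulr_natl natrM -mulrA ler_wpM2l.
Unshelve. all: by end_near.
Qed.

(** * Complete graphs and the upper bound *)

Lemma complete_graph_girth3 (t : nat) : (3 <= t)%N -> girth3 (complete_graph t).
Proof.
move=> t3.
have t0 : (0 < t)%N by apply: leq_trans t3.
have t1 : (1 < t)%N by apply: leq_trans t3.
by exists (Ordinal t0), (Ordinal t1), (Ordinal t3).
Qed.

Lemma complete_copyP (t n : nat) (H : subgraph n) :
  is_copy (complete_graph t) H ->
  #|H.1| = t /\ forall e, e \in edges H <->
    exists x y, [/\ x != y, x \in H.1, y \in H.1 & e = [set x; y]].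
Proof.
case/existsP=> f /andP[/injectiveP finj /eqP->] /=; split.
  by rewrite card_imset // card_ord.
move=> e; split=> [/imsetP[[i j]]|[x [y [xy /imsetP[i _ xE] /imsetP[j _ yE] ->]]]].
  rewrite inE /= => ij ->; exists (f i), (f j).
  by rewrite (inj_eq finj) !imset_f.
subst x y; apply/imsetP; exists (i, j) => //; rewrite inE /=.
by rewrite -(inj_eq finj).
Qed.

(** Two vertices shared by copies of [K_t] give a shared edge. As [t >= 2], a copy is thus
    determined by its vertex set. *)
Lemma copies_linear_family (t n : nat) (A : {set subgraph n}) :
  (2 <= t)%N -> edge_disjoint_copies (complete_graph t) A ->
  [/\ linear_family [set H.1 | H in A], #|[set H.1 | H in A]| = #|A| &
      forall B, B \in [set H.1 | H in A] -> #|B| = t].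
Proof.
move=> t2 /andP[/forall_inP copies /forall_inP disj].
have share H H' x y : H \in A -> H' \in A -> x != y -> x \in H.1 -> y \in H.1 ->
    x \in H'.1 -> y \in H'.1 -> H = H'.
  move=> HA HA' xy xH yH xH' yH'; apply/eqP; apply: contraT => ne.
  move/forall_inP/(_ H' HA')/implyP/(_ ne): (disj H HA) => /pred0P/(_ [set x; y]).
  have [_ edg] := complete_copyP (copies H HA).
  have [_ edg'] := complete_copyP (copies H' HA').
  by rewrite /= (proj2 (edg _)) ?(proj2 (edg' _)) //; exists x, y.
split.
- move=> _ _ x y /imsetP[H HA ->] /imsetP[H' HA' ->] xy xH yH xH' yH'.
  by rewrite (share H H' x y).
- apply: card_in_imset => H H' HA HA' EH.
  have [cH _] := complete_copyP (copies H HA).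
  have /card_gt1P[x [y [xH yH xy]]] : (1 < #|H.1|)%N by rewrite cH.
  by apply: (share H H' x y) => //; rewrite -EH.
- by move=> _ /imsetP[H HA ->]; have [] := complete_copyP (copies H HA).
Qed.

(** Two distinct edges have at least three endpoints, and no copy contains three vertices of a
    generic sequence. *)
Lemma generic_seq_rainbow (t n : nat) (A : {set subgraph n}) (ws : seq 'I_n) :
  edge_disjoint_copies (complete_graph t) A ->
  generic_seq [set H.1 | H in A] ws ->
  has_rainbow (complete_graph (size ws)) A.
Proof.
move=> /andP[/forall_inP copies _] gen; have [uws joins] := generic_seq_joined gen.
pose f : {ffun complete_graph (size ws) -> 'I_n} := [ffun i => tnth (in_tuple ws) i].
have finj : injective f.
  move=> i j; rewrite !ffunE => E; apply/val_inj/eqP.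
  have x0 := tnth (in_tuple ws) i.
  by move/eqP: E; rewrite !(tnth_nth x0) nth_uniq.
have fws i : f i \in ws by rewrite ffunE mem_tnth.
apply/existsP; exists (image_graph f); apply/andP; split.
  by apply/existsP; exists f; rewrite eqxx andbT; apply/injectiveP.
have edgeP e : e \in edges (image_graph f) ->
    exists x y, [/\ x != y, x \in ws, y \in ws & e = [set x; y]].
  case/imsetP=> -[i j]; rewrite inE /= => ij ->.
  by exists (f i), (f j); rewrite (inj_eq finj) !fws.
apply/andP; split.
  apply/subsetP => e /edgeP[x [y [xy xw yw ->]]].
  have /andP[_ /exists_inP[_ /imsetP[H HA ->] /andP[xH yH]]] := joins x y xw yw xy.
  apply/bigcupP; exists H => //.
  by have [_ edg] := complete_copyP (copies H HA); apply/edg; exists x, y.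
apply/forall_inP => e1 /edgeP[a [b [ab aw bw e1E]]].
apply/forall_inP => e2 /edgeP[c [d [cd cw dw e2E]]]; apply/implyP => e12.
apply/forall_inP => H HA; apply/forall_inP => H' HA'; apply/implyP.
case/andP=> e1H e2H; apply/eqP => EH; subst H'.
have HB : H.1 \in [set K.1 | K in A] by exact: imset_f.
have inH e x : e \in edges H -> x \in e -> x \in H.1.
  have [_ edg] := complete_copyP (copies H HA).
  by case/edg=> y [z [_ yH zH ->]]; rewrite in_set2 => /orP[]/eqP->.
have aH : a \in H.1 by apply: inH e1H _; rewrite e1E set21.
have bH : b \in H.1 by apply: inH e1H _; rewrite e1E set22.
have third z : z \in ws -> z \in e2 -> z \in [set a; b].
  move=> zw ze; apply: contraT; rewrite in_set2 negb_or => /andP[za zb].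
  have := generic_seq_three gen HB aw bw zw ab; rewrite eq_sym zb eq_sym za.
  by move=> /(_ isT isT); rewrite aH bH (inH _ _ e2H ze).
have := third _ cw; have := third _ dw; rewrite e2E set21 set22 !in_set2.
move=> /(_ isT) dab /(_ isT) cab; case/negP: e12; rewrite e1E e2E.
move: dab cab cd => /orP[]/eqP-> /orP[]/eqP->; rewrite ?eqxx // => _.
by rewrite setUC.
Qed.

Lemma subquadratic_complete (R : realType) (t r : nat) :
  (3 <= r)%N -> (r <= t)%N ->
  subquadratic R (fun n => multicolor_ex (complete_graph t) n (complete_graph r)).
Proof.
move=> r3 rt; apply/eqoP => eps eps0.
have r2 : (2 <= r)%N by exact: ltnW.
have [N clique] := @linear_family_clique R t r eps eps0 r2 rt.
exists N => // n /= Nn; rewrite ger0_norm // ger0_norm ?exprn_ge0 //.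
(* The bound holds for 0, the value of an empty maximum, passes to [maxn], and remains to be shown
   for each packing. *)
apply: (big_ind (fun k : nat => k%:R <= eps * n%:R ^+ 2)).
- by rewrite mulr_ge0 ?exprn_ge0 // ltW.
- by move=> a b; rewrite /maxn; case: ifP.
move=> A /andP[copies norb]; rewrite leNgt; apply: contra norb => big.
have [lin cA cB] := copies_linear_family (leq_trans r2 rt) copies.
have [|| ws [<- gen]] := clique _ _ _ lin cB.
- by rewrite card_ord.
- by rewrite cA card_ord.
- exact: generic_seq_rainbow copies gen.
Qed.

Theorem theorem1p5 (R : realType) :
  (forall t r : nat, (3 <= r)%N -> (r <= t)%N ->
     near_quadratic_lower R
       (fun n => multicolor_ex (complete_graph t) n (complete_graph r)) /\
     subquadratic R
       (fun n => multicolor_ex (complete_graph t) n (complete_graph r))) /\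
  (forall F G : sgraph,
     connected_graph F -> connected_graph G -> girth3 F -> girth3 G ->
     near_quadratic_lower R (fun n => multicolor_ex F n G)).
Proof.
split=> [t r r3 rt|F G _ _]; last exact: near_quadratic_multicolor_ex.
split; last exact: subquadratic_complete.
apply: near_quadratic_multicolor_ex; apply: complete_graph_girth3 => //.
exact: leq_trans rt.
Qed.
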